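(* Let $b\ge2$ and $n\ge2$. Then (i) there are integers $m\ge1$ and $k$ with $0\le k\le (b-1)m-2$ such that $K(n)=b^m+1+k$; (ii) if $b$ is odd, then both $K(n)$ and this $k$ are even.
   Context: Fix a base $b\ge2$. For $v\in\mathbb{N}$, $s(v)$ is the sum of the base-$b$ digits of $v$, $f(v)=v+s(v)$, and $F(u)=|\{v\in\mathbb{N}: f(v)=u\}|$. For $n\ge1$, $K(n)$ denotes the smallest $u\in\mathbb{N}$ with $F(u)=n$. *)

(* Defs.v *)
From mathcomp Require Import all_boot.
From mathcomp Require Import boolp.

Set Implicit Arguments.
Unset Strict Implicit.
Unset Printing Implicit Defensive.

(* For b >= 2, [trunc_log b v] is the index of the leading base-b digit of
   v > 0; for v = 0 the only term is the digit 0. *)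
Definition s (b v : nat) : nat :=
  \sum_(i < (trunc_log b v).+1) (v %/ b ^ i) %% b.

Definition f (b v : nat) : nat := v + s b v.

Lemma leq_f (b v : nat) : v <= f b v.
Proof. exact: leq_addr. Qed.

(* By [leq_f], every v : nat with f b v = u satisfies v < u.+1, so restricting
   the range to 'I_u.+1 loses no preimage. *)
Definition F (b u : nat) : nat := #|[set v : 'I_u.+1 | f b v == u]|.

(* K b n takes the junk value 0 when n is not a value of F b.  In particular,
   K b n > 0 is possible only if F b attains the value n. *)
Definition K (b n : nat) : nat :=
  if pselect (exists u, F b u == n) is left exF then ex_minn exF else 0.

Lemma K_spec (b n : nat) : (exists u, F b u = n) ->
  F b (K b n) = n /\ forall u, F b u = n -> K b n <= u.
Proof.
move=> [u0 Fu0]; rewrite /K; case: pselect => [exF|[]]; last first.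
  by exists u0; apply/eqP.
by case: ex_minnP => k /eqP Fk kmin; split=> // u /eqP /kmin.
Qed.

(* Main.v *)
(* Write [M = b^m + 1].  Splitting off the leading digit, [f (d b^m + w) =
   d M + f w] for [w < b^m], and complementing digits, [f w + f (b^m - 1 - w) =
   b^m - 1 + (b - 1) m].  Since the latter is less than [2 M], at most two values
   of the leading digit contribute to the preimages of [u = q M + k], namely [q]
   and [q - 1]; the digit [q - 1] contributes only if [k + 2 <= (b - 1) m].  When
   both contribute, [q] may be replaced by 1 without changing the count, so
   [K n] has the form [M + k].
   The same count gives [F (M + k) = F k + F ((b - 1) m - 2 - k)].  Choosing [k]
   with [F k = 1] in the right class modulo [b - 1], it shows that if [n] is a
   value of [F] then so is [n + 1]; hence [K n] is not a junk value. *)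
Require Import Defs.
From mathcomp Require Import all_boot.
From mathcomp Require Import zify.

Set Implicit Arguments.
Unset Strict Implicit.

Lemma sum_ord_mul (d N : nat) (g : nat -> nat) :
  \sum_(v < d * N) g v = \sum_(i < d) \sum_(w < N) g (i * N + w).
Proof.
elim: d => [|d IH]; first by rewrite mul0n !big_ord0.
rewrite big_ord_recr /= -IH mulSn addnC big_split_ord /=.
by congr (_ + _); apply: eq_bigr.
Qed.

Lemma digit_sum_widen (b v m n : nat) : 0 < b -> v < b ^ m -> m <= n ->
  \sum_(i < n) (v %/ b ^ i) %% b = \sum_(i < m) (v %/ b ^ i) %% b.
Proof.
move=> b0 vm /subnKC <-; elim: (n - m) => [|j IH]; first by rewrite addn0.
rewrite addnS big_ord_recr /= IH divn_small ?mod0n ?addn0 //.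
by rewrite expnD (leq_trans vm) // leq_pmulr // expn_gt0 b0.
Qed.

(** Padding with leading zeros frees the digit count from [trunc_log]. *)
Lemma s_digits (b v m : nat) : 2 <= b -> v < b ^ m ->
  s b v = \sum_(i < m) (v %/ b ^ i) %% b.
Proof.
move=> hb vm; have vt := @trunc_log_ltn b v hb.
rewrite /s; have [le|/ltnW le] := leqP (trunc_log b v).+1 m.
  by rewrite (@digit_sum_widen b v _ m (ltnW hb) vt le).
by rewrite (@digit_sum_widen b v m _ (ltnW hb) vm le).
Qed.

Lemma f_lead (b m d w : nat) : 2 <= b -> d < b -> w < b ^ m ->
  f b (d * b ^ m + w) = d * (b ^ m + 1) + f b w.
Proof.
move=> hb db wm; have b_gt0 : 0 < b ^ m by rewrite expn_gt0; lia.
have vm : d * b ^ m + w < b ^ m.+1.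
  rewrite expnS; apply: (@leq_trans (d.+1 * b ^ m)); first by rewrite mulSn; lia.
  by rewrite leq_mul2r db orbT.
rewrite /f (@s_digits _ _ m.+1) // (@s_digits _ w m) // big_ord_recr /=.
rewrite divnMDl // (divn_small wm) addn0 (modn_small db).
suff -> : \sum_(i < m) (d * b ^ m + w) %/ b ^ i %% b =
          \sum_(i < m) w %/ b ^ i %% b.
  by rewrite [X in _ + X]addnC addnACA mulnDr muln1.
apply: eq_bigr => -[i im] _ /=.
have bi_gt0 : 0 < b ^ i by rewrite expn_gt0; lia.
(* Since [i < m], dividing [d * b ^ m] by [b ^ i] leaves a multiple of [b], which vanishes modulo
   [b]. *)
have -> : b ^ m = b ^ (m - i).-1 * b * b ^ i.
  by rewrite -expnSr -expnD; congr (b ^ _); lia.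
by rewrite !mulnA divnMDl // modnMDl.
Qed.

Lemma f0 (b : nat) : 2 <= b -> f b 0 = 0.
Proof. by move=> hb; rewrite /f (@s_digits b 0 0) // big_ord0. Qed.

Lemma ltn_lead (b m v : nat) : 2 <= b -> v < b ^ m.+1 ->
  exists d w, [/\ d < b, w < b ^ m & v = d * b ^ m + w].
Proof.
move=> hb vm; have b_gt0 : 0 < b ^ m by rewrite expn_gt0; lia.
exists (v %/ b ^ m), (v %% b ^ m); split; last exact: divn_eq.
  by rewrite ltn_divLR // -expnS.
by rewrite ltn_mod.
Qed.

Lemma f_complement (b m w : nat) : 2 <= b -> w < b ^ m ->
  f b w + f b (b ^ m - 1 - w) = b ^ m - 1 + (b - 1) * m.
Proof.
move=> hb; elim: m w => [|m IH] w wm.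
  have -> : w = 0 by lia.
  by rewrite expn0 !subnn f0 // muln0.
have [d [w' [db w'm ->]]] := ltn_lead hb wm.
(* [c] is the leading digit of the complement. *)
set c := b - 1 - d; have bE : b = c + d + 1 by rewrite /c; lia.
have cb : c < b by lia.
have bm : b ^ m.+1 = c * b ^ m + d * b ^ m + b ^ m.
  by rewrite expnS {1}bE !mulnDl mul1n.
have -> : b ^ m.+1 - 1 - (d * b ^ m + w') = c * b ^ m + (b ^ m - 1 - w').
  by move: (c * _) (d * _) bm => x y; lia.
rewrite !f_lead //; last lia.
have := IH _ w'm; rewrite bm mulnS !mulnDr !muln1.
by move: (c * _) (d * _) ((b - 1) * m) => x y z; lia.
Qed.

(** Each leading digit split off contributes a multiple of [b ^ m + 1], which is even or, for
    [m = 0], equal to 2. *)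
Lemma even_f (b v : nat) : 2 <= b -> odd b -> ~~ odd (f b v).
Proof.
move=> hb ob; have : v < b ^ v by apply: ltn_expl.
move: {2}v => m; elim: m v => [|m IH] v vm.
  have -> : v = 0 by lia.
  by rewrite f0.
have [d [w [db wm ->]]] := ltn_lead hb vm.
by rewrite f_lead // oddD oddM oddD oddX ob orbT andbF /= IH.
Qed.

Lemma ltn_bernoulli (b m : nat) : 2 <= b -> (b - 1) * m < b ^ m.
Proof.
move=> hb; elim: m => [|m IH]; first by rewrite muln0.
rewrite expnS mulnS; nia.
Qed.

(** The cutoff [N] is independent of [u], so that [N = b ^ m] allows induction on the number of
    digits. *)
Definition preimages (b N u : nat) : nat := \sum_(v < N) (f b v == u).

Lemma F_preimages (b N u : nat) : u < N -> F b u = preimages b N u.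
Proof.
move=> uN; rewrite /F -sum1_card big_mkcond /preimages.
rewrite (eq_bigr (fun v : 'I_u.+1 => (f b v == u) : nat)); last first.
  by move=> i _; rewrite inE; case: (_ == _).
rewrite -(subnKC uN) big_split_ord /= [X in _ + X]big1 ?addn0 // => i _.
by apply/eqP; rewrite eqb0; apply/eqP => e; have := leq_f b (u.+1 + i); lia.
Qed.

Lemma preimages_gt0 (b N u : nat) : 0 < preimages b N u -> exists v, f b v = u.
Proof.
rewrite lt0n sum_nat_eq0 => /forallPn [v]; rewrite negb_imply eqb0 negbK.
by move=> /andP [_ /eqP <-]; exists v.
Qed.

Lemma F_gt0 (b u : nat) : 0 < F b u -> exists v, f b v = u.
Proof. by rewrite (@F_preimages _ u.+1) //; apply: preimages_gt0. Qed.

Lemma preimages_large (b m u : nat) : 2 <= b ->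
  b ^ m + (b - 1) * m <= u -> preimages b (b ^ m) u = 0.
Proof.
move=> hb hu; apply: big1 => -[v vm] _ /=.
by apply/eqP; rewrite eqb0; apply/eqP => e; have := f_complement hb vm; lia.
Qed.

(** The reflection of [v] to [b ^ m - 1 - v] exchanges the two preimage sets. *)
Lemma preimages_complement (b m k : nat) : 2 <= b -> k + 2 <= (b - 1) * m ->
  preimages b (b ^ m) (b ^ m + 1 + k) =
  preimages b (b ^ m) ((b - 1) * m - 2 - k).
Proof.
move=> hb hk; rewrite /preimages (reindex_inj rev_ord_inj) /=.
apply: eq_bigr => -[v vm] _ /=; congr nat_of_bool.
have := f_complement hb vm; rewrite -subnDA add1n.
by move=> e; apply/eqP/eqP; lia.
Qed.

Lemma preimages_lead (b m q k : nat) : 2 <= b -> k < b ^ m + 1 ->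
  preimages b (b ^ m.+1) (q * (b ^ m + 1) + k) =
    (if q < b then preimages b (b ^ m) k else 0) +
    (if 0 < q <= b then preimages b (b ^ m) (b ^ m + 1 + k) else 0).
Proof.
move=> hb kM; rewrite {1}/preimages expnS
  (@sum_ord_mul b (b ^ m) (fun v => f b v == q * (b ^ m + 1) + k)).
have term (i : nat) : i < b ->
    \sum_(w < b ^ m) (f b (i * b ^ m + w) == q * (b ^ m + 1) + k) =
    (i == q) * preimages b (b ^ m) k +
    (i.+1 == q) * preimages b (b ^ m) (b ^ m + 1 + k).
  move=> ib; rewrite /preimages !big_distrr -big_split /=.
  apply: eq_bigr => -[w wm] _ /=; rewrite f_lead //.
  have := f_complement hb wm; have := ltn_bernoulli m hb.
  set M := b ^ m + 1 => bern comp.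
  have fw : f b w < 2 * M by lia.
  have [->|iq] := eqVneq i q.
    by rewrite eqn_add2l (_ : (q.+1 == q) = false) ?mul1n ?mul0n ?addn0 //; lia.
  rewrite mul0n add0n.
  have [<-|iq'] := eqVneq i.+1 q.
    by rewrite mulSn mul1n -addnA addnCA eqn_add2l.
  apply/eqP; rewrite mul0n eqb0; apply/eqP => e.
  (* A digit above [q] overshoots because [k < M]; one below [q - 1] would need [f b w >= 2 * M]. *)
  have [lt|ge] := ltnP i q; last by nia.
  have : i.+2 * M <= q * M by rewrite leq_mul2r; lia.
  by rewrite !mulSn; lia.
rewrite (eq_bigr (fun i : 'I_b => (i == q :> nat) * preimages b (b ^ m) k +
    (i.+1 == q) * preimages b (b ^ m) (b ^ m + 1 + k))); last first.
  by move=> i _; apply: term.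
rewrite big_split /= -!big_distrl /=.
have cnt (r : nat) : \sum_(i < b) (i == r :> nat) = (r < b).
  have [rb|br] := ltnP r b.
    rewrite (bigD1 (Ordinal rb)) //= eqxx big1 // => i /eqP ir.
    by apply/eqP; rewrite eqb0; apply/eqP => e; apply: ir; apply: val_inj.
  by apply: big1 => i _; apply/eqP; rewrite eqb0; have := ltn_ord i; lia.
rewrite cnt; congr (_ + _); first by case: ifP; rewrite ?mul1n.
case: q {term} => [|q] /=; first by rewrite big1.
rewrite (eq_bigr (fun i : 'I_b => (i == q :> nat) : nat)) ?cnt //.
by case: ifP; rewrite ?mul1n.
Qed.

Lemma F_shift (b m q k : nat) : 2 <= b -> 0 < q < b -> k + 2 <= (b - 1) * m ->
  preimages b (b ^ m.+1) (q * (b ^ m + 1) + k) = F b (b ^ m + 1 + k).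
Proof.
move=> hb /andP [q0 qb] hk; have bern := ltn_bernoulli m hb.
rewrite (@F_preimages _ (b ^ m.+1)); last by rewrite expnS; nia.
rewrite -[in RHS](mul1n (b ^ m + 1)) !preimages_lead //; try lia.
by rewrite qb q0 (ltnW qb) (ltnW hb) hb.
Qed.

Lemma F_add (b m k : nat) : 2 <= b -> k + 2 <= (b - 1) * m ->
  F b (b ^ m + 1 + k) = F b k + F b ((b - 1) * m - 2 - k).
Proof.
move=> hb hk; have bern := ltn_bernoulli m hb.
rewrite -(@F_shift _ _ 1) // preimages_lead //; last lia.
rewrite hb (ltnW hb) preimages_complement //.
by congr (_ + _); rewrite -F_preimages //; lia.
Qed.

(** Descent on the digit count: while only one leading digit contributes, dropping it keeps the
    count and does not increase the target. It stops before [m = 0], where at most one preimage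
    exists. *)
Lemma preimages_reduce (b m n u : nat) : 2 <= b -> 2 <= n ->
  preimages b (b ^ m) u = n ->
  exists m' k, [/\ k + 2 <= (b - 1) * m', F b (b ^ m' + 1 + k) = n
    & b ^ m' + 1 + k <= u].
Proof.
move=> hb hn; elim: m u => [|m IH] u.
  by rewrite /preimages expn0 big_ord1; case: eqP; lia.
set M := b ^ m + 1; have M0 : 0 < M by rewrite /M; lia.
rewrite (divn_eq u M); move: (u %/ M) (ltn_pmod u M0) => q; move: (u %% M) => k.
move=> kM; have [hk|hk] := leqP (k + 2) ((b - 1) * m); last first.
  rewrite preimages_lead // -/M (_ : preimages b (b ^ m) (M + k) = 0); last first.
    by apply: preimages_large; rewrite // /M; lia.
  rewrite if_same addn0; case: ifP => _ e; last lia.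
  by have [m' [k' [? ? le]]] := IH _ e; exists m', k'; split=> //; lia.
have [q0b|nq0b] := boolP (0 < q < b).
  rewrite F_shift // => e; exists m, k; split=> //.
  by rewrite leq_add2r -/M leq_pmull //; lia.
(* Here [q = 0] leaves only digit 0, [q = b] only digit [b - 1], and a larger [q] none. *)
rewrite preimages_lead //.
have [qb|bq] := ltnP q b.
  have -> /= : q = 0 by lia.
  by rewrite addn0 mul0n add0n; apply: IH.
case: ifP => [/andP [q0 _]|_] e; last lia.
have [m' [k' [? ? le]]] := IH _ e; exists m', k'; split=> //.
by apply: leq_trans le _; rewrite -/M leq_add2r leq_pmull.
Qed.

(** The preimage is the digit [w]. A two-digit [b + r] has value [b + 1 + 2 * r], excluded by parity
    or by size; a leading digit of at least 2 gives too large a value. *)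
Lemma F_double (b w : nat) : 2 <= b -> w < b -> ~~ odd b || (w.*2 <= b) ->
  F b w.*2 = 1.
Proof.
move=> hb wb hw.
have f1 r : r < b -> f b r = r.*2.
  move=> rb; have := @f_lead b 0 r 0 hb rb isT.
  by rewrite expn0 muln1 addn0 f0 //; lia.
rewrite /F; apply/eqP/cards1P.
have wl : w < w.*2.+1 by lia.
exists (Ordinal wl); apply/setP => -[v vl]; rewrite !inE -val_eqE /=.
apply/eqP/eqP => [e|->]; last exact: f1.
have v2 : v < b ^ 2 by rewrite -mulnn; nia.
have [d [r []]] := ltn_lead hb v2; rewrite expn1 => db rb ve.
have := f_lead (m := 1) hb db; rewrite expn1 => /(_ r rb).
rewrite -ve e f1 //; case: d db ve => [|[|d]] db ve; [by lia| |by nia].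
case/orP: hw; lia.
Qed.

Lemma F_surj (b n : nat) : 2 <= b -> 0 < n -> exists u, F b u = n.
Proof.
move=> hb; elim: n => // -[_ _|n /(_ isT) [u Fu] _].
  by exists 0; apply: (@F_double b 0); lia.
have ev : odd b -> ~~ odd u.
  move=> ob; have [|v <-] := @F_gt0 b u; first by rewrite Fu.
  exact: even_f.
have [m [w [wb hw e]]] : exists m w,
    [/\ w < b, ~~ odd b || (w.*2 <= b) & (b - 1) * m = u + 2 + w.*2].
  have B0 : 0 < b - 1 by lia.
  have := divn_eq (u + 2) (b - 1); have := ltn_pmod (u + 2) B0.
  move: (_ %/ _) (_ %% _) => q r rb ue.
  (* The gap from [u + 2] to the next multiple of [b - 1] should be [w.*2]. An odd gap forces [b]
     even, and adding the odd number [b - 1] repairs the parity. *)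
  have [obr|obr] := boolP (odd (b - 1 - r)).
    have evb : ~~ odd b.
      by apply/negP => ob; move: (ev ob) (congr1 odd ue); rewrite !oddD oddM; lia.
    exists (q + 2), ((b - 1 - r + (b - 1))./2); rewrite evb.
    by split=> //; nia.
  by exists q.+1, ((b - 1 - r)./2); split; [lia|apply/orP; right; lia|nia].
exists (b ^ m + 1 + w.*2); rewrite F_add //; last lia.
rewrite F_double // (_ : (b - 1) * m - 2 - w.*2 = u) ?Fu //; lia.
Qed.

Unset Implicit Arguments.
Set Strict Implicit.

Theorem theorem4p1 (b n : nat) (hb : 2 <= b) (hn : 2 <= n) :
  exists m k : nat,
    [/\ 1 <= m,
        k + 2 <= (b - 1) * m,
        K b n = b ^ m + 1 + k
      & odd b -> ~~ odd (K b n) /\ ~~ odd k].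
Proof.
have [FK Kmin] := K_spec (F_surj hb (ltnW hn)).
have KN : preimages b (b ^ K b n) (K b n) = n.
  by rewrite -F_preimages // ltn_expl.
have [m [k [hk Fk leK]]] := preimages_reduce hb hn KN.
have eK : K b n = b ^ m + 1 + k.
  (* The reduced target also has [n] preimages, so minimality forces equality. *)
  by apply/eqP; rewrite eqn_leq leK andbT; apply: Kmin.
exists m, k; split=> //; first by case: m hk {Fk leK eK}; lia.
move=> ob; have [|v ev] := @F_gt0 b (K b n); first by rewrite FK; lia.
have oK : ~~ odd (K b n) by rewrite -ev; apply: even_f.
by split=> //; move: oK; rewrite eK !oddD oddX ob orbT.
Qed.
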